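(* The axiom VSMALL is not provable in the subsystem RCA$_0$ + WWKL of second-order arithmetic; i.e., there is a model (indeed an $\omega$-model) of RCA$_0$ + WWKL in which VSMALL fails.
   Context: Binary strings are elements of $2^{<\mathbb{N}}$; a tree is a subset of $2^{<\mathbb{N}}$ closed under initial segments, with root the empty string; $[T]$ is the set of infinite paths through $T$. A node $\sigma\in T$ is extendible if $\{\tau\in T:\tau\supseteq\sigma\}$ is infinite; $\mathrm{Ext}(T)$ is the set of extendible nodes. $\sigma\in T$ is a branching node if both $\sigma0$ and $\sigma1$ are extendible; $\mathrm{Br}(T)$ is the set of branching nodes. WWKL (weak weak König's lemma) is the axiom: every binary tree $T$ for which there is a rational $q>0$ such that for all $n$, $|\{\sigma\in T:|\sigma|=n\}|/2^n\ge q$, has an infinite path. VSMALL is the axiom: if $T$ is an infinite binary tree such that there is no function $f:\mathbb{N}\to\mathbb{N}$ such that for infinitely many $n$ the set $\{|\sigma|:\sigma\in\mathrm{Br}(T),\ |\sigma|<f(n)\}$ has at least $n$ elements (i.e. no $f$ bounds the principal function of the branching level set $\{|\sigma|:\sigma\in\mathrm{Br}(T)\}$ infinitely often), then $T$ has an infinite path. *)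

(* Defs.v *)
From Stdlib Require Import Arith List.
Import ListNotations.

Inductive code : Type :=
| CZero
| CSucc
| CProj (i : nat)
| COrc
| CComp (f : code) (gs : list code)
| CPrim (f g : code)
| CMu (f : code).

Inductive eval (A : nat -> bool) : code -> list nat -> nat -> Prop :=
| eZero xs : eval A CZero xs 0
| eSucc x xs : eval A CSucc (x :: xs) (S x)
| eProj i xs : i < length xs -> eval A (CProj i) xs (nth i xs 0)
| eOrc x xs : eval A COrc (x :: xs) (if A x then 1 else 0)
| eComp f gs xs ys y :
    evals A gs xs ys -> eval A f ys y -> eval A (CComp f gs) xs y
| ePrim0 f g xs y : eval A f xs y -> eval A (CPrim f g) (0 :: xs) y
| ePrimS f g n xs z y :
    eval A (CPrim f g) (n :: xs) z -> eval A g (n :: z :: xs) y ->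
    eval A (CPrim f g) (S n :: xs) y
| eMu f xs y :
    eval A f (y :: xs) 0 ->
    (forall z, z < y -> exists w, w <> 0 /\ eval A f (z :: xs) w) ->
    eval A (CMu f) xs y
with evals (A : nat -> bool) : list code -> list nat -> list nat -> Prop :=
| esNil xs : evals A nil xs nil
| esCons g gs xs y ys :
    eval A g xs y -> evals A gs xs ys -> evals A (g :: gs) xs (y :: ys).

Definition computable_in (A : nat -> bool) (f : nat -> nat) : Prop :=
  exists e : code, forall n, eval A e [n] (f n).

Definition Treducible (B A : nat -> bool) : Prop :=
  computable_in A (fun n => if B n then 1 else 0).

Definition Tjoin (A B : nat -> bool) : nat -> bool :=
  fun n => if Nat.even n then A (Nat.div2 n) else B (Nat.div2 n).

(** omega-models of RCA_0 = Turing ideals *)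
Definition Turing_ideal (M : (nat -> bool) -> Prop) : Prop :=
  (exists X, M X) /\
  (forall A B, M A -> M B -> M (Tjoin A B)) /\
  (forall A B, M A -> Treducible B A -> M B).

Definition bstring := list bool.

(** Bijective coding of binary strings by natural numbers *)
Fixpoint strcode (s : bstring) : nat :=
  match s with
  | [] => 0
  | b :: s' => 2 * strcode s' + (if b then 2 else 1)
  end.

Definition strset_in (M : (nat -> bool) -> Prop) (T : bstring -> bool) : Prop :=
  exists X, M X /\ forall s, X (strcode s) = T s.

Definition fun_in (M : (nat -> bool) -> Prop) (f : nat -> nat) : Prop :=
  exists X, M X /\ computable_in X f.

Definition is_prefix (s t : bstring) : Prop := exists u, t = s ++ u.

Definition is_tree (T : bstring -> bool) : Prop :=
  forall s t, T (s ++ t) = true -> T s = true.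

Definition infinite_strs (S : bstring -> Prop) : Prop :=
  forall l : list bstring, exists x, S x /\ ~ In x l.

Fixpoint prefix (P : nat -> bool) (k : nat) : bstring :=
  match k with
  | 0 => []
  | S k' => prefix P k' ++ [P k']
  end.

Definition is_path (T : bstring -> bool) (P : nat -> bool) : Prop :=
  forall k, T (prefix P k) = true.

Fixpoint all_strings (n : nat) : list bstring :=
  match n with
  | 0 => [[]]
  | S n' => map (cons false) (all_strings n') ++ map (cons true) (all_strings n')
  end.

Definition level_count (T : bstring -> bool) (n : nat) : nat :=
  length (filter T (all_strings n)).

Definition extendible (T : bstring -> bool) (s : bstring) : Prop :=
  infinite_strs (fun t => T t = true /\ is_prefix s t).

Definition branching (T : bstring -> bool) (s : bstring) : Prop :=
  T s = true /\ extendible T (s ++ [false]) /\ extendible T (s ++ [true]).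

Definition at_least (S : nat -> Prop) (n : nat) : Prop :=
  exists l : list nat, NoDup l /\ length l = n /\ forall k, In k l -> S k.

(** WWKL: positive-measure trees (measure >= q = a/b > 0) have paths in M *)
Definition WWKL_in (M : (nat -> bool) -> Prop) : Prop :=
  forall T : bstring -> bool, strset_in M T -> is_tree T ->
  (exists a b : nat, 0 < a /\ 0 < b /\
     forall n, a * 2 ^ n <= level_count T n * b) ->
  exists P, M P /\ is_path T P.

Definition VSMALL_in (M : (nat -> bool) -> Prop) : Prop :=
  forall T : bstring -> bool, strset_in M T -> is_tree T ->
  infinite_strs (fun s => T s = true) ->
  ~ (exists f, fun_in M f /\
       forall N, exists n, N <= n /\
         at_least (fun k => k < f n /\ exists s, length s = k /\ branching T s) n) ->
  exists P, M P /\ is_path T P.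

(* Main.v *)
From Stdlib Require Import Arith List Lia Reals Lra Classical ClassicalEpsilon FunctionalExtensionality.
From Stdlib Require Cantor.
Require Import Defs.
Import ListNotations.

(** The sequence [K] lists partial information "x_i = b" about the paths of a tree,
    a string being rejected only once it is longer than the stage of the information
    it violates; the branching levels are the positions never decided.  [K] is generic:
    before reserving the [n]-th free position [l], one extends the finite part of [K] until two
    measures are within 2^-n of their suprema over all extensions respecting the
    positions reserved so far, for each of the first functionals [e]: the measure of the
    [X] for which [e] converges at [n + 1], and the measure of the [X] for which [e] already
    contradicts [K].  The first makes values above [l] appear only with small measure;
    the second makes it improbable that [e] commits to a bit at [l], since deciding [l] the other
    way would increase the contradicting set.  So for almost every [X], the tree together
    with [X] computes no path of the tree and no function escaping the free positions.
    By Fubini this survives the iterated adjunction of paths through trees of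
    positive measure, which yields an omega-model of WWKL. *)

(** * Oracle computations *)

Definition agree (s : nat) (A B : nat -> bool) : Prop := forall x, x < s -> A x = B x.

Lemma agree_le s t A B : s <= t -> agree t A B -> agree s A B.
Proof. intros H1 H2 x Hx. apply H2. lia. Qed.

Lemma agree_sym s A B : agree s A B -> agree s B A.
Proof. intros H x Hx. symmetry. auto. Qed.

Lemma agree_trans s A B C : agree s A B -> agree s B C -> agree s A C.
Proof. intros H1 H2 x Hx. rewrite H1; auto. Qed.

(* The automatic scheme misses the subderivations of [eMu], which occur below an existential. *)
Lemma eval_evals_ind (A : nat -> bool) (P : code -> list nat -> nat -> Prop)
  (Q : list code -> list nat -> list nat -> Prop) :
  (forall xs, P CZero xs 0) ->
  (forall x xs, P CSucc (x :: xs) (S x)) ->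
  (forall i xs, i < length xs -> P (CProj i) xs (nth i xs 0)) ->
  (forall x xs, P COrc (x :: xs) (Nat.b2n (A x))) ->
  (forall f gs xs ys y, Q gs xs ys -> P f ys y -> P (CComp f gs) xs y) ->
  (forall f g xs y, P f xs y -> P (CPrim f g) (0 :: xs) y) ->
  (forall f g n xs z y, P (CPrim f g) (n :: xs) z -> P g (n :: z :: xs) y ->
     P (CPrim f g) (S n :: xs) y) ->
  (forall f xs y, P f (y :: xs) 0 ->
     (forall z, z < y -> exists w, w <> 0 /\ P f (z :: xs) w) -> P (CMu f) xs y) ->
  (forall xs, Q nil xs nil) ->
  (forall g gs xs y ys, P g xs y -> Q gs xs ys -> Q (g :: gs) xs (y :: ys)) ->
  forall e xs y, eval A e xs y -> P e xs y.
Proof.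
  intros H1 H2 H3 H4 H5 H6 H7 H8 H9 H10.
  refine (fix ev e xs y (H : eval A e xs y) {struct H} : P e xs y :=
    match H in eval _ e xs y return P e xs y with
    | eZero _ xs => H1 xs
    | eSucc _ x xs => H2 x xs
    | eProj _ i xs h => H3 i xs h
    | eOrc _ x xs => H4 x xs
    | eComp _ f gs xs ys y hs h => H5 f gs xs ys y (evs gs xs ys hs) (ev f ys y h)
    | ePrim0 _ f g xs y h => H6 f g xs y (ev _ _ _ h)
    | ePrimS _ f g n xs z y h h' => H7 f g n xs z y (ev _ _ _ h) (ev _ _ _ h')
    | eMu _ f xs y h hz => H8 f xs y (ev _ _ _ h)
        (fun z lt => match hz z lt with
          | ex_intro _ w (conj n h') => ex_intro _ w (conj n (ev _ _ _ h')) end)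
    end
  with evs gs xs ys (H : evals A gs xs ys) {struct H} : Q gs xs ys :=
    match H in evals _ gs xs ys return Q gs xs ys with
    | esNil _ xs => H9 xs
    | esCons _ g gs xs y ys h hs => H10 g gs xs y ys (ev _ _ _ h) (evs _ _ _ hs)
    end
  for ev).
Qed.

Lemma eval_functional A e xs y y' : eval A e xs y -> eval A e xs y' -> y = y'.
Proof.
  intros H. revert y'. revert e xs y H.
  apply (eval_evals_ind A (fun e xs y => forall y', eval A e xs y' -> y = y')
    (fun gs xs ys => forall ys', evals A gs xs ys' -> ys = ys')).
  - intros xs y' H. inversion H; reflexivity.
  - intros x xs y' H. inversion H; reflexivity.
  - intros i xs Hi y' H. inversion H; reflexivity.
  - intros x xs y' H. inversion H; reflexivity.
  - intros f gs xs ys y IHs IH y' H. inversion H as [| | | | ? ? ? ys' ? Hs Hf | | |]; subst.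
    apply IHs in Hs; subst. auto.
  - intros f g xs y IH y' H. inversion H; subst. auto.
  - intros f g n xs z y IH1 IH2 y' H. inversion H as [| | | | | | ? ? ? ? z' ? Hz Hg |]; subst.
    apply IH1 in Hz; subst. auto.
  - intros f xs y IH IHz y' H. inversion H as [| | | | | | | ? ? ? H0 Hlt]; subst.
    destruct (Nat.lt_trichotomy y y') as [L | [L | L]]; auto.
    + destruct (Hlt y L) as (w & Hw & Hw'). apply IH in Hw'. congruence.
    + destruct (IHz y' L) as (w & Hw & Hw'). apply Hw' in H0. congruence.
  - intros xs ys' H. inversion H; reflexivity.
  - intros g gs xs y ys IH IHs ys' H. inversion H; subst.
    f_equal; auto.
Qed.

Lemma bounded_uniform (P : nat -> nat -> Prop) n :
  (forall z s t, s <= t -> P z s -> P z t) ->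
  (forall z, z < n -> exists s, P z s) -> exists s, forall z, z < n -> P z s.
Proof.
  intros Hm. induction n as [|n IH]; intros H.
  - exists 0. lia.
  - destruct IH as [s Hs]; [intros; apply H; lia|].
    destruct (H n) as [t Ht]; [lia|].
    exists (s + t). intros z Hz. destruct (Nat.eq_dec z n) as [->|].
    + apply Hm with t; auto; lia.
    + apply Hm with s; [lia|]. apply Hs. lia.
Qed.

Lemma eval_use A e xs y :
  eval A e xs y -> exists s, forall B, agree s A B -> eval B e xs y.
Proof.
  revert e xs y.
  apply (eval_evals_ind A
    (fun e xs y => exists s, forall B, agree s A B -> eval B e xs y)
    (fun gs xs ys => exists s, forall B, agree s A B -> evals B gs xs ys)).
  - exists 0. intros. constructor.
  - exists 0. intros. constructor.
  - exists 0. intros. constructor. auto.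
  - intros x xs. exists (S x). intros B HB. rewrite (HB x) by lia. apply eOrc.
  - intros f gs xs ys y [s Hs] [t Ht]. exists (s + t). intros B HB.
    apply eComp with ys.
    + apply Hs. apply agree_le with (s + t); auto; lia.
    + apply Ht. apply agree_le with (s + t); auto; lia.
  - intros f g xs y [s Hs]. exists s. intros. constructor; auto.
  - intros f g n xs z y [s Hs] [t Ht]. exists (s + t). intros B HB.
    apply ePrimS with z.
    + apply Hs. apply agree_le with (s + t); auto; lia.
    + apply Ht. apply agree_le with (s + t); auto; lia.
  - intros f xs y [s Hs] Hz.
    destruct (bounded_uniform
      (fun z s => forall B, agree s A B -> exists w, w <> 0 /\ eval B f (z :: xs) w) y)
      as [t Ht].
    { intros z a b Hab H B HB. apply H. apply agree_le with b; auto. }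
    { intros z Hlt. destruct (Hz z Hlt) as (w & Hw & t & Ht).
      exists t. intros B HB. exists w. auto. }
    exists (s + t). intros B HB. apply eMu.
    + apply Hs. apply agree_le with (s + t); auto; lia.
    + intros z Hlt. apply Ht; auto. apply agree_le with (s + t); auto; lia.
  - exists 0. intros. constructor.
  - intros g gs xs y ys [s Hs] [t Ht]. exists (s + t). intros B HB. constructor.
    + apply Hs. apply agree_le with (s + t); auto; lia.
    + apply Ht. apply agree_le with (s + t); auto; lia.
Qed.

(** * Turing reductions and joins *)

Definition computes (A : nat -> bool) (d : code) (B : nat -> bool) : Prop :=
  forall n, eval A d [n] (Nat.b2n (B n)).

Fixpoint plug (d e : code) : code :=
  match e with
  (* [d] is only known to be correct on one-element argument lists, so the projection cuts off the
     remaining arguments. *)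
  | COrc => CComp d [CProj 0]
  | CComp f gs => CComp (plug d f) (map (plug d) gs)
  | CPrim f g => CPrim (plug d f) (plug d g)
  | CMu f => CMu (plug d f)
  | _ => e
  end.

Lemma eval_plug A B d e xs y : computes A d B -> eval B e xs y -> eval A (plug d e) xs y.
Proof.
  intros Hd. revert e xs y.
  apply (eval_evals_ind B (fun e xs y => eval A (plug d e) xs y)
    (fun gs xs ys => evals A (map (plug d) gs) xs ys)); cbn; intros.
  - constructor.
  - constructor.
  - constructor; auto.
  - apply eComp with [x]; auto.
    constructor; [|constructor]. apply (eProj A 0 (x :: xs)). cbn; lia.
  - apply eComp with ys; auto.
  - constructor; auto.
  - apply ePrimS with z; auto.
  - constructor; auto.
  - constructor.
  - constructor; auto.
Qed.

Lemma Treducible_trans A B C : Treducible C B -> Treducible B A -> Treducible C A.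
Proof.
  intros [e He] [d Hd]. exists (plug d e). intros n. apply eval_plug with B; auto.
Qed.

Lemma computable_in_trans A B f : computable_in B f -> Treducible B A -> computable_in A f.
Proof.
  intros [e He] [d Hd]. exists (plug d e). intros n. apply eval_plug with B; auto.
Qed.

Definition evens (Y : nat -> bool) : nat -> bool := fun n => Y (2 * n).
Definition odds (Y : nat -> bool) : nat -> bool := fun n => Y (2 * n + 1).

Lemma evens_Tjoin A B : evens (Tjoin A B) = A.
Proof.
  apply functional_extensionality. intros n. unfold evens, Tjoin.
  rewrite Nat.even_even, Nat.div2_double. reflexivity.
Qed.

Lemma odds_Tjoin A B : odds (Tjoin A B) = B.
Proof.
  apply functional_extensionality. intros n. unfold odds, Tjoin.
  rewrite Nat.even_odd, Nat.add_1_r, Nat.div2_succ_double. reflexivity.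
Qed.

Lemma agree_evens s A B : agree (2 * s) A B -> agree s (evens A) (evens B).
Proof. intros H x Hx. apply H. lia. Qed.

Lemma agree_odds s A B : agree (2 * s) A B -> agree s (odds A) (odds B).
Proof. intros H x Hx. apply H. lia. Qed.

Lemma agree_Tjoin s A A' B B' :
  agree s A A' -> agree s B B' -> agree (2 * s) (Tjoin A B) (Tjoin A' B').
Proof.
  intros HA HB x Hx. unfold Tjoin. rewrite Nat.div2_div.
  assert (x / 2 < s) by (apply Nat.Div0.div_lt_upper_bound; lia).
  destruct (Nat.even x); auto.
Qed.

Ltac ev_step :=
  match goal with
  | |- evals _ _ _ _ => econstructor
  | |- eval ?A (CProj ?i) ?xs _ => apply (eProj A i xs); cbn; lia
  | |- eval _ (CComp _ _) _ _ => econstructor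
  | |- eval _ CZero _ _ => apply eZero
  | |- eval _ CSucc _ _ => apply eSucc
  | |- eval _ COrc _ _ => apply eOrc
  end.

Definition cadd : code := CPrim (CProj 0) (CComp CSucc [CProj 1]).

Lemma eval_cadd A m n : eval A cadd [m; n] (m + n).
Proof.
  induction m as [|m IH]; cbn.
  - apply ePrim0. ev_step.
  - apply ePrimS with (m + n); [exact IH|]. repeat ev_step.
Qed.

Definition cdouble : code := CComp cadd [CProj 0; CProj 0].

Lemma eval_cdouble A n : eval A cdouble [n] (2 * n).
Proof.
  replace (2 * n) with (n + n) by lia.
  apply eComp with [n; n]; [repeat ev_step | apply eval_cadd].
Qed.

Definition ciszero : code := CPrim (CComp CSucc [CZero]) CZero.

Lemma eval_ciszero A n : eval A ciszero [n] (Nat.b2n (n =? 0)).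
Proof.
  induction n as [|n IH].
  - apply ePrim0. repeat ev_step.
  - eapply ePrimS; [exact IH | apply eZero].
Qed.

Definition cparity : code := CPrim CZero (CComp ciszero [CProj 1]).

Lemma eval_cparity A n : eval A cparity [n] (Nat.b2n (Nat.odd n)).
Proof.
  induction n as [|n IH].
  - apply ePrim0. apply eZero.
  - eapply ePrimS; [exact IH|].
    apply eComp with [Nat.b2n (Nat.odd n)]; [repeat ev_step|].
    replace (Nat.odd (S n)) with (Nat.b2n (Nat.odd n) =? 0); [apply eval_ciszero|].
    rewrite Nat.odd_succ, <- Nat.negb_odd. destruct (Nat.odd n); reflexivity.
Qed.

Definition cdiv2 : code := CPrim CZero (CComp cadd [CProj 1; CComp cparity [CProj 0]]).

Lemma eval_cdiv2 A n : eval A cdiv2 [n] (Nat.div2 n).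
Proof.
  induction n as [|n IH].
  - apply ePrim0. apply eZero.
  - eapply ePrimS; [exact IH|].
    replace (Nat.div2 (S n)) with (Nat.div2 n + Nat.b2n (Nat.odd n)).
    + apply eComp with [Nat.div2 n; Nat.b2n (Nat.odd n)]; [|apply eval_cadd].
      econstructor; [ev_step|]. econstructor; [|constructor].
      apply eComp with [n]; [repeat ev_step | apply eval_cparity].
    + pose proof (Nat.div2_odd n). pose proof (Nat.div2_odd (S n)) as H1.
      rewrite Nat.odd_succ, <- Nat.negb_odd in H1.
      destruct (Nat.odd n); cbn [Nat.b2n negb] in *; lia.
Qed.

(** Primitive recursion on the parity serves as case distinction: at 0, [CProj 0] selects the value
    of [d1]; at 1, the argument list starts with the predecessor and the recursive value, so
    [CProj 3] selects that of [d2]. *)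
Definition cjoin (d1 d2 : code) : code :=
  CComp (CPrim (CProj 0) (CProj 3)) [cparity; CComp d1 [cdiv2]; CComp d2 [cdiv2]].

Lemma computes_cjoin A d1 d2 B C :
  computes A d1 B -> computes A d2 C -> computes A (cjoin d1 d2) (Tjoin B C).
Proof.
  intros H1 H2 n.
  apply eComp with
    [Nat.b2n (Nat.odd n); Nat.b2n (B (Nat.div2 n)); Nat.b2n (C (Nat.div2 n))].
  - econstructor; [apply eval_cparity|].
    econstructor; [|econstructor; [|constructor]];
      (apply eComp with [Nat.div2 n]; [|auto]; econstructor; [apply eval_cdiv2 | constructor]).
  - unfold Tjoin. rewrite <- Nat.negb_odd. destruct (Nat.odd n); cbn [Nat.b2n negb].
    + eapply ePrimS; [apply ePrim0; ev_step|].
      apply (eProj A 3 [0; Nat.b2n (B (Nat.div2 n)); _; Nat.b2n (C (Nat.div2 n))]). cbn; lia.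
    + apply ePrim0.
      apply (eProj A 0 [Nat.b2n (B (Nat.div2 n)); Nat.b2n (C (Nat.div2 n))]). cbn; lia.
Qed.

Definition cevens : code := CComp COrc [cdouble].
Definition codds : code := CComp COrc [CComp CSucc [cdouble]].

Lemma computes_cevens Y : computes Y cevens (evens Y).
Proof.
  intros n. apply eComp with [2 * n]; [|apply eOrc].
  econstructor; [apply eval_cdouble | constructor].
Qed.

Lemma computes_codds Y : computes Y codds (odds Y).
Proof.
  intros n. apply eComp with [2 * n + 1]; [|apply eOrc].
  econstructor; [|constructor]. rewrite Nat.add_1_r.
  apply eComp with [2 * n]; [|apply eSucc]. econstructor; [apply eval_cdouble | constructor].
Qed.

Lemma computes_plug A B C d e :
  computes A d B -> computes B e C -> computes A (plug d e) C.
Proof. intros H1 H2 n. apply eval_plug with B; auto. Qed.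

(** A functional reading [(Z + X) + Y] has to be turned into one reading [Z + (X + Y)], where
    [X + Y] is a single random set. *)
Definition reassoc (Y : nat -> bool) : nat -> bool :=
  Tjoin (Tjoin (evens Y) (evens (odds Y))) (odds (odds Y)).

Lemma reassoc_Tjoin A B C : reassoc (Tjoin A (Tjoin B C)) = Tjoin (Tjoin A B) C.
Proof. unfold reassoc. now rewrite !odds_Tjoin, !evens_Tjoin. Qed.

Lemma agree_reassoc s Y W : agree (4 * s) Y W -> agree s (reassoc Y) (reassoc W).
Proof.
  intros H. replace (4 * s) with (2 * (2 * s)) in H by lia.
  assert (He : agree (2 * s) (evens Y) (evens W)) by now apply agree_evens.
  assert (Ho : agree (2 * s) (odds Y) (odds W)) by now apply agree_odds.
  unfold reassoc. apply agree_le with (2 * s); [lia|].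
  apply agree_Tjoin.
  - apply agree_le with (2 * s); [lia|]. apply agree_Tjoin.
    + apply agree_le with (2 * s); [lia | auto].
    + now apply agree_evens.
  - now apply agree_odds.
Qed.

Definition creassoc : code :=
  cjoin (cjoin cevens (plug codds cevens)) (plug codds codds).

Lemma computes_creassoc Y : computes Y creassoc (reassoc Y).
Proof.
  repeat apply computes_cjoin.
  - apply computes_cevens.
  - eapply computes_plug; [apply computes_codds | apply computes_cevens].
  - eapply computes_plug; apply computes_codds.
Qed.

Lemma Treducible_Tjoin A B C : Treducible B A -> Treducible C A -> Treducible (Tjoin B C) A.
Proof. intros [d Hd] [e He]. exists (cjoin d e). exact (computes_cjoin _ _ _ _ _ Hd He). Qed.

Lemma Treducible_Tjoin_l A B : Treducible A (Tjoin A B).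
Proof.
  exists cevens. pose proof (computes_cevens (Tjoin A B)) as H.
  rewrite evens_Tjoin in H. exact H.
Qed.

Lemma Treducible_Tjoin_r A B : Treducible B (Tjoin A B).
Proof.
  exists codds. pose proof (computes_codds (Tjoin A B)) as H.
  rewrite odds_Tjoin in H. exact H.
Qed.

Lemma Treducible_refl A : Treducible A A.
Proof. exists COrc. intros n. apply eOrc. Qed.

(** * Numbering of functionals and computations of bounded use *)

Fixpoint encode (c : code) : nat :=
  match c with
  | CZero => Cantor.to_nat (0, 0)
  | CSucc => Cantor.to_nat (1, 0)
  | CProj i => Cantor.to_nat (2, i)
  | COrc => Cantor.to_nat (3, 0)
  | CComp f gs => Cantor.to_nat (4, Cantor.to_nat (encode f,
      fold_right (fun g a => S (Cantor.to_nat (encode g, a))) 0 gs))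
  | CPrim f g => Cantor.to_nat (5, Cantor.to_nat (encode f, encode g))
  | CMu f => Cantor.to_nat (6, encode f)
  end.

Lemma encode_inj c c' : encode c = encode c' -> c = c'.
Proof.
  (* The recursion is set up by hand, since it is also called on the members of [gs] inside an
     induction on that list. *)
  revert c c'. fix IH 1. intros c c' H.
  destruct c, c'; cbn [encode] in H;
    apply Cantor.to_nat_inj, pair_equal_spec in H; destruct H as [Ht H];
    try discriminate Ht; try reflexivity.
  - now subst.
  - apply Cantor.to_nat_inj, pair_equal_spec in H. destruct H as [Hf Hgs].
    f_equal; [exact (IH _ _ Hf)|].
    revert gs0 Hgs. induction gs as [|g gs IHgs]; intros [|g' gs'] Hgs; try discriminate Hgs.
    + reflexivity.
    + cbn [fold_right] in Hgs. apply Nat.succ_inj, Cantor.to_nat_inj, pair_equal_spec in Hgs.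
      destruct Hgs as [Hg Hgs].
      f_equal; [exact (IH _ _ Hg) | exact (IHgs _ Hgs)].
  - apply Cantor.to_nat_inj, pair_equal_spec in H. destruct H as [Hf Hg].
    f_equal; [exact (IH _ _ Hf) | exact (IH _ _ Hg)].
  - f_equal. exact (IH _ _ H).
Qed.

Definition decode (n : nat) : code := epsilon (inhabits CZero) (fun c => encode c = n).

Lemma decode_encode c : decode (encode c) = c.
Proof.
  apply encode_inj. unfold decode. apply epsilon_spec. now exists c.
Qed.

(** The use is bounded instead of the number of steps: the first [s] bits of [Y] must settle the
    computation. For fixed [s] this is an event about finitely many bits, so the finite average [pr]
    measures it exactly. *)
Definition graph (e : code) (s : nat) (Y : nat -> bool) (i y : nat) : Prop :=
  forall Y', agree s Y Y' -> eval Y' e [i] y.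

Lemma graph_mono e s t Y Y' i y :
  s <= t -> agree s Y Y' -> graph e s Y i y -> graph e t Y' i y.
Proof.
  intros Hst Ha H W HW. apply H. apply agree_trans with Y'; auto.
  now apply agree_le with t.
Qed.

Lemma graph_functional e s t Y i y y' : graph e s Y i y -> graph e t Y i y' -> y = y'.
Proof.
  intros H H'. apply eval_functional with Y e [i]; [apply H | apply H']; easy.
Qed.
(** * Finite averages over Cantor space *)

Definition scons (b : bool) (X : nat -> bool) : nat -> bool :=
  fun n => match n with 0 => b | S m => X m end.

Lemma scons_eta X : scons (X 0) (fun n => X (S n)) = X.
Proof. apply functional_extensionality. now intros [|n]. Qed.

Lemma agree_scons n b X Y : agree n X Y -> agree (S n) (scons b X) (scons b Y).
Proof. intros H [|x] Hx; cbn; auto. apply H. lia. Qed.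

(* An integral only for [f] depending on the first [n] bits: later bits are set to [false]. *)
Fixpoint avg (n : nat) (f : (nat -> bool) -> R) : R :=
  match n with
  | 0 => f (fun _ => false)
  | S n => ((avg n (fun X => f (scons false X)) + avg n (fun X => f (scons true X))) / 2)%R
  end.

Definition ind (P : Prop) : R := if excluded_middle_informative P then 1%R else 0%R.

Definition pr (n : nat) (P : (nat -> bool) -> Prop) : R := avg n (fun X => ind (P X)).

Definition depends (n : nat) (P : (nat -> bool) -> Prop) : Prop :=
  forall X Y, agree n X Y -> P X -> P Y.

Ltac ind_cases :=
  unfold ind; repeat destruct (excluded_middle_informative _); try lra; try (exfalso; tauto).

Lemma avg_le n f g : (forall X, f X <= g X)%R -> (avg n f <= avg n g)%R.
Proof.
  revert f g. induction n as [|n IH]; intros f g H; cbn; auto.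
  assert (H0 := IH (fun X => f (scons false X)) (fun X => g (scons false X)) (fun X => H _)).
  assert (H1 := IH (fun X => f (scons true X)) (fun X => g (scons true X)) (fun X => H _)).
  lra.
Qed.

Lemma avg_plus n f g : avg n (fun X => f X + g X)%R = (avg n f + avg n g)%R.
Proof.
  revert f g. induction n as [|n IH]; intros f g; cbn; auto.
  rewrite (IH (fun X => f (scons false X))), (IH (fun X => f (scons true X))). lra.
Qed.

Lemma avg_scal n c f : avg n (fun X => c * f X)%R = (c * avg n f)%R.
Proof.
  revert f. induction n as [|n IH]; intros f; cbn; auto.
  rewrite (IH (fun X => f (scons false X))), (IH (fun X => f (scons true X))). lra.
Qed.

Lemma avg_const n c : avg n (fun _ => c) = c.
Proof. induction n as [|n IH]; cbn; auto. rewrite IH. lra. Qed.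

Lemma avg_stable s t f :
  (forall X Y, agree s X Y -> f X = f Y) -> s <= t -> avg t f = avg s f.
Proof.
  revert t f. induction s as [|s IH]; intros t f Hf Hst.
  - cbn. transitivity (avg t (fun _ => f (fun _ => false))); [|apply avg_const].
    f_equal. apply functional_extensionality. intros X. apply Hf. intros x Hx. lia.
  - destruct t as [|t]; [lia|]. cbn.
    rewrite !(IH t); auto; try lia;
      intros X Y HXY; apply Hf; now apply agree_scons.
Qed.

(** Removing the first bit of an interleaving exchanges the two components; two uses remove one bit
    from each. *)
Lemma Tjoin_scons b A B : Tjoin (scons b A) B = scons b (Tjoin B A).
Proof.
  apply functional_extensionality. intros [|n]; [reflexivity|].
  cbn [scons]. unfold Tjoin. rewrite Nat.even_succ, <- Nat.negb_even.
  pose proof (Nat.div2_odd n) as H1. pose proof (Nat.div2_odd (S n)) as H2.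
  rewrite Nat.odd_succ in H2. rewrite <- Nat.negb_even in H1.
  destruct (Nat.even n); cbn [negb Nat.b2n] in *.
  - f_equal. lia.
  - replace (Nat.div2 (S n)) with (S (Nat.div2 n)) by lia. reflexivity.
Qed.

(** Fubini for interleaved bits: in each induction step the first bits of [X] and [Y] are bits 0 and
    1 of the join, and linearity moves the average over the bit of [Y] outside. *)
Lemma avg_Tjoin s f :
  avg s (fun X => avg s (fun Y => f (Tjoin X Y))) = avg (2 * s) f.
Proof.
  revert f. induction s as [|s IH]; intros f.
  - cbn. f_equal. apply functional_extensionality. intros n. unfold Tjoin.
    now destruct (Nat.even n).
  - replace (2 * S s) with (S (S (2 * s))) by lia. cbn [avg].
    rewrite <- !IH.
    assert (E : forall b, avg s (fun X =>
        ((avg s (fun Y => f (Tjoin (scons b X) (scons false Y))) +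
          avg s (fun Y => f (Tjoin (scons b X) (scons true Y)))) / 2)%R) =
      ((avg s (fun X => avg s (fun Y => f (scons b (scons false (Tjoin X Y))))) +
        avg s (fun X => avg s (fun Y => f (scons b (scons true (Tjoin X Y)))))) / 2)%R).
    { intros b. transitivity (avg s (fun X => (1 / 2) *
        (avg s (fun Y => f (scons b (scons false (Tjoin X Y)))) +
         avg s (fun Y => f (scons b (scons true (Tjoin X Y))))))%R).
      - f_equal. apply functional_extensionality. intros X.
        transitivity ((avg s (fun Y => f (scons b (scons false (Tjoin X Y)))) +
         avg s (fun Y => f (scons b (scons true (Tjoin X Y))))) / 2)%R; [|lra].
        f_equal. f_equal; f_equal; apply functional_extensionality; intros Y;
          now rewrite !Tjoin_scons.
      - rewrite avg_scal, avg_plus. lra. }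
    rewrite !E. reflexivity.
Qed.

Lemma pr_ge0 n P : (0 <= pr n P)%R.
Proof.
  rewrite <- (avg_const n 0%R). apply avg_le. intros X. ind_cases.
Qed.

Lemma pr_le1 n P : (pr n P <= 1)%R.
Proof.
  rewrite <- (avg_const n 1%R). apply avg_le. intros X. ind_cases.
Qed.

Lemma pr_true n (P : _ -> Prop) : (forall X, P X) -> pr n P = 1%R.
Proof.
  intros H. rewrite <- (avg_const n 1%R). unfold pr. f_equal.
  apply functional_extensionality. intros X. specialize (H X). ind_cases.
Qed.

Lemma pr_false n (P : _ -> Prop) : (forall X, ~ P X) -> pr n P = 0%R.
Proof.
  intros H. rewrite <- (avg_const n 0%R). unfold pr. f_equal.
  apply functional_extensionality. intros X. specialize (H X). ind_cases.
Qed.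

Lemma pr_le n (P Q : _ -> Prop) : (forall X, P X -> Q X) -> (pr n P <= pr n Q)%R.
Proof. intros H. apply avg_le. intros X. specialize (H X). ind_cases. Qed.

Lemma pr_le_depends s t (P Q : _ -> Prop) :
  s <= t -> depends s P -> (forall X, P X -> Q X) -> (pr s P <= pr t Q)%R.
Proof.
  intros Hst HP H. apply Rle_trans with (pr t P); [|now apply pr_le].
  right. symmetry. apply avg_stable; auto. intros X Y HXY.
  assert (P X <-> P Y) by (split; apply HP; auto using agree_sym).
  ind_cases.
Qed.

Lemma pr_or n (P Q S : _ -> Prop) :
  (forall X, S X -> P X \/ Q X) -> (pr n S <= pr n P + pr n Q)%R.
Proof.
  intros H. unfold pr. rewrite <- avg_plus. apply avg_le. intros X.
  specialize (H X). ind_cases.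
Qed.

Lemma pr_disjoint n (P Q S : _ -> Prop) :
  (forall X, P X -> Q X -> False) -> (forall X, P X \/ Q X -> S X) ->
  (pr n P + pr n Q <= pr n S)%R.
Proof.
  intros H H'. unfold pr. rewrite <- avg_plus. apply avg_le. intros X.
  specialize (H X). specialize (H' X). ind_cases.
Qed.

(** The weights add up to [1 - (1 / 2) ^ k], which bounds the union by [c] uniformly in [k]. *)
Lemma pr_union_bound n (V : nat -> (nat -> bool) -> Prop) c k :
  (forall i, pr n (V i) <= c * (1 / 2) ^ S i)%R ->
  (pr n (fun X => exists i : nat, (i < k)%nat /\ V i X) <= c * (1 - (1 / 2) ^ k))%R.
Proof.
  intros H. induction k as [|k IH].
  - rewrite pr_false; [cbn; lra|]. intros X (i & Hi & _). lia.
  - apply Rle_trans with (pr n (fun X => exists i : nat, (i < k)%nat /\ V i X) + pr n (V k))%R.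
    + apply pr_or. intros X (i & Hi & HV). destruct (Nat.eq_dec i k) as [->|]; auto.
      left. exists i. split; auto. lia.
    + specialize (H k). cbn in *. lra.
Qed.

Lemma markov n d f :
  (forall X, 0 <= f X)%R -> (d * pr n (fun X => d < f X) <= avg n f)%R.
Proof.
  intros H. unfold pr. rewrite <- avg_scal. apply avg_le. intros X.
  specialize (H X). ind_cases.
Qed.

Lemma depends_scons n b (P : (nat -> bool) -> Prop) :
  depends (S n) P -> depends n (fun X => P (scons b X)).
Proof. intros H X Y HXY. apply H. now apply agree_scons. Qed.

(** Only finitely many patterns of [n] bits exist, and one witness for each suffices. *)
Lemma depends_uniform n (P : (nat -> bool) -> nat -> Prop) :
  (forall k, depends n (fun X => P X k)) ->
  exists M, forall X, (exists k, P X k) -> exists k, k <= M /\ P X k.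
Proof.
  revert P. induction n as [|n IH]; intros P HP.
  - destruct (classic (exists X k, P X k)) as [(X & k & H) | H].
    + exists k. intros Y _. exists k. split; auto. apply HP with X; auto.
      intros x Hx. lia.
    + exists 0. intros X [k Hk]. exfalso. eauto.
  - destruct (IH (fun X => P (scons false X))) as [M0 H0].
    { intros k. apply (depends_scons n false (fun X => P X k)). auto. }
    destruct (IH (fun X => P (scons true X))) as [M1 H1].
    { intros k. apply (depends_scons n true (fun X => P X k)). auto. }
    exists (M0 + M1). intros X HX.
    rewrite <- (scons_eta X) in HX |- *.
    destruct (X 0); [apply H1 in HX | apply H0 in HX];
      destruct HX as (k & Hk & HP'); exists k; (split; [lia | auto]).
Qed.

(** * Dependent choice and compactness *)

Lemma dependent_sequence (S : Type) (P : nat -> S -> Prop) (T : nat -> S -> S -> Prop) x0 :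
  P 0 x0 -> (forall n x, P n x -> exists y, P (Datatypes.S n) y /\ T n x y) ->
  exists s, s 0 = x0 /\ forall n, P n (s n) /\ T n (s n) (s (Datatypes.S n)).
Proof.
  intros H0 H.
  pose (step := fun n (x : {x | P n x}) =>
    let c := constructive_indefinite_description _ (H n (proj1_sig x) (proj2_sig x)) in
    exist (P (Datatypes.S n)) (proj1_sig c) (proj1 (proj2_sig c))).
  pose (s := fix s n : {x | P n x} :=
    match n with 0 => exist _ x0 H0 | Datatypes.S n => step n (s n) end).
  exists (fun n => proj1_sig (s n)). split; [reflexivity|].
  intros n. split; [apply proj2_sig|].
  exact (proj2 (proj2_sig (constructive_indefinite_description _
    (H n (proj1_sig (s n)) (proj2_sig (s n)))))).
Qed.

(** Compactness of Cantor space for a decreasing sequence of nonempty clopen sets. *)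
Lemma konig (C : nat -> (nat -> bool) -> Prop) :
  (forall n, depends n (C n)) -> (forall n X, C (S n) X -> C n X) ->
  (forall n, exists X, C n X) -> exists X, forall n, C n X.
Proof.
  intros Hd Hdec Hne.
  assert (Hle : forall m n X, m <= n -> C n X -> C m X).
  { intros m n X Hmn. induction Hmn; auto. }
  (* The cylinder of the first [n] bits of [X] meets every [C N]. If both one-bit extensions failed,
     at [N0] and [N1], then [C (N0 + N1)] would miss the cylinder. *)
  pose (live := fun n X => forall N, exists Y, agree n X Y /\ C N Y).
  destruct (dependent_sequence _ live (fun n X Y => agree n X Y) (fun _ => false))
    as (s & _ & Hs).
  { intros N. destruct (Hne N) as [Y HY]. exists Y. split; auto. intros x Hx. lia. }
  { intros n X HX.
    pose (X' := fun b k => if k =? n then b else X k).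
    assert (HX' : forall b, agree n X (X' b)).
    { intros b x Hx. unfold X'. destruct (Nat.eqb_spec x n); auto. lia. }
    destruct (classic (exists b, live (S n) (X' b))) as [[b Hb] | Hno].
    { exists (X' b). auto. }
    exfalso.
    assert (Hf : forall b, exists N, ~ exists Y, agree (S n) (X' b) Y /\ C N Y).
    { intros b. apply not_all_ex_not. intros H. apply Hno. now exists b. }
    destruct (Hf false) as [N0 H0], (Hf true) as [N1 H1].
    destruct (HX (N0 + N1)) as (Y & HXY & HY).
    assert (HY' : agree (S n) (X' (Y n)) Y).
    { intros x Hx. unfold X'. destruct (Nat.eqb_spec x n) as [->|]; auto.
      apply HXY. lia. }
    destruct (Y n); [apply H1 | apply H0]; exists Y; (split; [auto|]);
      apply Hle with (N0 + N1); auto; lia. }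
  pose (X := fun n => s (S n) n).
  assert (Ha : forall m n, m <= n -> agree m (s m) (s n)).
  { intros m n Hmn. induction Hmn as [|n Hmn IH].
    - intros x Hx. auto.
    - apply agree_trans with (s n); auto. apply agree_le with n; auto. apply Hs. }
  exists X. intros n. destruct (proj1 (Hs n) n) as (Y & HY & HC).
  apply Hd with Y; auto. apply agree_sym. apply agree_trans with (s n); auto.
  intros x Hx. unfold X. apply (Ha (S x) n); lia.
Qed.

Lemma prefix_scons b X k : prefix (scons b X) (S k) = b :: prefix X k.
Proof.
  induction k as [|k IH]; [reflexivity|].
  change (prefix (scons b X) (S (S k))) with (prefix (scons b X) (S k) ++ [X k]).
  now rewrite IH.
Qed.

Lemma level_count_succ (T : bstring -> bool) n :
  level_count T (S n) =
    level_count (fun s => T (false :: s)) n + level_count (fun s => T (true :: s)) n.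
Proof.
  unfold level_count. cbn [all_strings]. rewrite filter_app, length_app.
  assert (E : forall b l,
    length (filter T (map (cons b) l)) = length (filter (fun s => T (b :: s)) l)).
  { intros b l. induction l as [|x l IH]; cbn; auto.
    destruct (T (b :: x)); cbn; auto. }
  now rewrite !E.
Qed.

(** Translates the counting hypothesis of WWKL into a lower bound for [pr]. *)
Lemma level_count_pr (T : bstring -> bool) n :
  INR (level_count T n) = (2 ^ n * pr n (fun X => T (prefix X n) = true))%R.
Proof.
  revert T. induction n as [|n IH]; intros T.
  - unfold level_count, pr. cbn. destruct (T []); cbn; ind_cases; congruence.
  - rewrite level_count_succ, plus_INR, !IH. unfold pr. cbn [avg pow].
    rewrite (functional_extensionality
      (fun X => ind (T (prefix (scons false X) (S n)) = true))
      (fun X => ind (T (false :: prefix X n) = true)))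
      by (intros X; now rewrite prefix_scons).
    rewrite (functional_extensionality
      (fun X => ind (T (prefix (scons true X) (S n)) = true))
      (fun X => ind (T (true :: prefix X n) = true)))
      by (intros X; now rewrite prefix_scons).
    lra.
Qed.

Lemma prefix_agree n X Y : agree n X Y -> prefix X n = prefix Y n.
Proof.
  induction n as [|n IH]; intros H; cbn; auto.
  rewrite IH, (H n); auto. apply agree_le with (S n); auto.
Qed.
(** * Preservation of null tests under adding paths of wide trees *)

Definition monotone_test (D : nat -> (nat -> nat -> Prop) -> Prop) : Prop :=
  forall j (g g' : nat -> nat -> Prop),
    (forall i y, g i y -> g' i y) -> D j g -> D j g'.

(* For every functional [e], the set of [X] such that [Z + X], read through [e], passes the test at all [j] is null. *)
Definition good (D : nat -> (nat -> nat -> Prop) -> Prop) (Z : nat -> bool) : Prop :=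
  forall e eps, (0 < eps)%R -> exists j : nat, forall s : nat,
    (pr s (fun X => D j (graph e s (Tjoin Z X))) <= eps)%R.

Lemma agree_Tjoin_r s Z X Y : agree s X Y -> agree (2 * s) (Tjoin Z X) (Tjoin Z Y).
Proof. intros H. apply agree_Tjoin; auto. intros x Hx; auto. Qed.

Lemma test_depends D j e s Z :
  monotone_test D -> depends s (fun X => D j (graph e s (Tjoin Z X))).
Proof.
  intros HD X Y HXY. apply HD. intros i y. apply graph_mono; auto.
  apply agree_le with (2 * s); [lia|]. now apply agree_Tjoin_r.
Qed.

Lemma graph_reassoc e s A B C i y :
  graph e s (Tjoin (Tjoin A B) C) i y ->
  graph (plug creassoc e) (4 * s) (Tjoin A (Tjoin B C)) i y.
Proof.
  intros H Y HY. apply eval_plug with (reassoc Y); [apply computes_creassoc|].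
  apply H. rewrite <- reassoc_Tjoin. now apply agree_reassoc.
Qed.

(** The average over [X] of the sections is the measure of one event about [X + Y], to which
    [good D Z] applies after reassociation. *)
Lemma good_joint D Z e eps :
  monotone_test D -> good D Z -> (0 < eps)%R -> exists j : nat, forall s : nat,
    (avg s (fun X => pr s (fun Y => D j (graph e s (Tjoin (Tjoin Z X) Y)))) <= eps)%R.
Proof.
  intros HD HZ Heps. destruct (HZ (plug creassoc e) eps Heps) as [j Hj].
  exists j. intros s.
  (* Reassociation raises the use to [4 * s]. As half of the bits read belong to [Z], this event
     still depends on only [2 * s] bits of [W]. *)
  pose (E := fun W => D j (graph (plug creassoc e) (4 * s) (Tjoin Z W))).
  apply Rle_trans with (avg s (fun X => avg s (fun Y => ind (E (Tjoin X Y))))).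
  - apply avg_le. intros X. apply pr_le. intros Y. apply HD. intros i y.
    apply graph_reassoc.
  - rewrite (avg_Tjoin s (fun W => ind (E W))).
    apply Rle_trans with (pr (4 * s) E); [|apply Hj].
    apply pr_le_depends; auto; [lia|].
    intros X Y HXY. apply HD. intros i y. apply graph_mono; auto.
    replace (4 * s) with (2 * (2 * s)) by lia. now apply agree_Tjoin_r.
Qed.

Lemma half_pow_pos n : (0 < (1 / 2) ^ n)%R.
Proof. apply pow_lt. lra. Qed.

Lemma half_pow_le m n : m <= n -> ((1 / 2) ^ n <= (1 / 2) ^ m)%R.
Proof.
  intros H. induction H as [|n H IH]; [lra|]. cbn. pose proof (half_pow_pos n). lra.
Qed.

Lemma half_pow_small eps : (0 < eps)%R -> exists k, ((1 / 2) ^ k < eps)%R.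
Proof.
  intros H. destruct (pow_lt_1_zero (1 / 2)) with (y := eps) as [N HN]; auto.
  - rewrite Rabs_pos_eq; lra.
  - exists N. specialize (HN N (le_n N)). rewrite Rabs_pos_eq in HN; auto.
    apply Rlt_le, half_pow_pos.
Qed.

(* By Fubini and Markov, the [X] for which some section [Z + X] has a large test set form an open set of small measure, so it cannot cover the paths of [S]. *)
Lemma good_extend D Z (S : bstring -> bool) (a b : nat) :
  monotone_test D -> good D Z -> is_tree S -> 0 < a -> 0 < b ->
  (forall n, a * 2 ^ n <= level_count S n * b) ->
  exists X, is_path S X /\ good D (Tjoin Z X).
Proof.
  intros HD HZ HS Ha Hb Hwide.
  set (q := (INR a / INR b)%R).
  assert (Ha' := lt_0_INR a Ha). assert (Hb' := lt_0_INR b Hb).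
  assert (Hq : (0 < q)%R) by (apply Rdiv_lt_0_compat; auto).
  assert (HSq : forall n, (q <= pr n (fun X => S (prefix X n) = true))%R).
  { intros n. specialize (Hwide n). apply le_INR in Hwide.
    rewrite !mult_INR, pow_INR, level_count_pr in Hwide.
    replace (INR 2) with 2%R in Hwide by (cbn; lra).
    assert (H2 : (0 < 2 ^ n)%R) by (apply pow_lt; lra).
    apply Rmult_le_reg_r with (INR b); auto. apply Rmult_le_reg_r with (2 ^ n)%R; auto.
    unfold q, Rdiv. rewrite (Rmult_assoc (INR a)), Rinv_l by lra. lra. }
  (* Requirement [i] codes a functional together with an exponent giving the tolerance [de i]. *)
  pose (ce := fun i => decode (fst (Cantor.of_nat i))).
  pose (de := fun i => ((1 / 2) ^ snd (Cantor.of_nat i))%R).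
  (* The factor [de i] is lost to the Markov inequality; the other factors sum to at most [q / 2]
     over all [i], less than the measure of the paths. *)
  assert (Hj : forall i, exists j : nat, forall s : nat,
    (avg s (fun X => pr s (fun Y => D j (graph (ce i) s (Tjoin (Tjoin Z X) Y))))
      <= de i * (q / 2 * (1 / 2) ^ Datatypes.S i))%R).
  { intros i. apply good_joint; auto. apply Rmult_lt_0_compat; [apply half_pow_pos|].
    apply Rmult_lt_0_compat; [lra | apply half_pow_pos]. }
  apply choice in Hj. destruct Hj as [j Hj].
  pose (g := fun i s X => pr s (fun Y => D (j i) (graph (ce i) s (Tjoin (Tjoin Z X) Y)))).
  assert (Hgm : forall i s t X Y, s <= t -> agree s X Y -> (g i s X <= g i t Y)%R).
  { intros i s t X Y Hst HXY. apply pr_le_depends; auto using test_depends.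
    intros W. apply HD. intros m y. apply graph_mono; auto.
    apply agree_le with (2 * s); [lia|]. apply agree_Tjoin; [|intros x Hx; auto].
    apply agree_le with (2 * s); [lia|]. now apply agree_Tjoin_r. }
  assert (HV : forall i s, (pr s (fun X => de i < g i s X) <= q / 2 * (1 / 2) ^ Datatypes.S i)%R).
  { intros i s. assert (0 < de i)%R by apply half_pow_pos.
    apply Rmult_le_reg_l with (de i); auto.
    apply Rle_trans with (avg s (g i s)); [|apply Hj].
    apply markov. intros X. apply pr_ge0. }
  destruct (konig (fun n X => S (prefix X n) = true /\
      forall i, i < n -> (g i n X <= de i)%R)) as [X HX].
  - intros n X Y HXY [H1 H2]. split; [now rewrite <- (prefix_agree n X Y)|].
    intros i Hi. apply Rle_trans with (g i n X); auto.
    apply Hgm; auto using agree_sym.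
  - intros n X [H1 H2]. split; [exact (HS _ _ H1)|].
    intros i Hi. apply Rle_trans with (g i (Datatypes.S n) X); [|apply H2; lia].
    apply Hgm; [lia|]. intros x Hx; auto.
  - intros n. apply NNPP. intros Hno.
    assert (H := pr_union_bound n (fun i X => (de i < g i n X)%R) (q / 2) n
      (fun i => HV i n)).
    assert (H1 : (q <= pr n (fun X => exists i : nat, (i < n)%nat /\ (de i < g i n X)%R))%R).
    { apply Rle_trans with (1 := HSq n). apply pr_le. intros X HX.
      apply NNPP. intros Hn. apply Hno. exists X. split; auto.
      intros i Hi. apply Rnot_lt_le. intros Hlt. apply Hn. now exists i. }
    pose proof (half_pow_pos n). assert (q / 2 * (1 - (1 / 2) ^ n) <= q / 2 * 1)%R.
    { apply Rmult_le_compat_l; lra. }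
    lra.
  - exists X. split; [intros k; apply HX|].
    intros e eps Heps. destruct (half_pow_small eps Heps) as [k Hk].
    set (i := Cantor.to_nat (encode e, k)). exists (j i). intros s.
    apply Rle_trans with (g i s X).
    + apply pr_le. intros Y. unfold ce, i. rewrite Cantor.cancel_of_to. cbn [fst].
      rewrite decode_encode. auto.
    (* The level must be at least [s] for monotonicity and exceed [i] for requirement [i] to be in
       force. *)
    + apply Rle_trans with (g i (i + 1 + s) X); [apply Hgm; [lia | intros x Hx; auto]|].
      apply Rle_trans with (de i); [apply HX; lia|].
      unfold de, i. rewrite Cantor.cancel_of_to. cbn [snd]. lra.
Qed.
(** * A generic narrow tree *)

Definition assignment := list (nat * bool).

(* [K t = (i, b)] reveals at stage [t] that paths have bit [b] at position [i]; only strings longer than [max t i] have to respect it. *)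
Definition obeys (K : nat -> nat * bool) (s : bstring) : Prop :=
  forall t i b, t < length s -> i < length s -> K t = (i, b) -> nth i s false = b.

Definition revealed_tree (K : nat -> nat * bool) (s : bstring) : bool :=
  if excluded_middle_informative (obeys K s) then true else false.

Definition tree_oracle (K : nat -> nat * bool) (n : nat) : bool :=
  if excluded_middle_informative (exists s, strcode s = n /\ obeys K s) then true else false.

Lemma strcode_inj s t : strcode s = strcode t -> s = t.
Proof.
  revert t. induction s as [|b s IH]; intros [|c t] H; cbn in H;
    try (destruct b; lia); try (destruct c; lia); auto.
  assert (b = c) by (destruct b, c; auto; lia). subst c.
  f_equal. apply IH. lia.
Qed.

Lemma length_le_strcode s : length s <= strcode s.
Proof. induction s as [|b s IH]; cbn; auto. destruct b; lia. Qed.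

Lemma revealed_tree_true K s : revealed_tree K s = true <-> obeys K s.
Proof.
  unfold revealed_tree. destruct (excluded_middle_informative _); intuition congruence.
Qed.

Lemma tree_oracle_strcode K s : tree_oracle K (strcode s) = revealed_tree K s.
Proof.
  unfold tree_oracle, revealed_tree.
  destruct (excluded_middle_informative (exists _, _)) as [(t & Ht & H) | H];
    destruct (excluded_middle_informative (obeys K s)) as [H' | H']; auto.
  - apply strcode_inj in Ht. congruence.
  - exfalso. eauto.
Qed.

(** A string is no longer than its code, so deciding a code below [n] consults [K] only below
    [n]. *)
Lemma tree_oracle_agree n K K' :
  (forall t, t < n -> K t = K' t) -> agree n (tree_oracle K) (tree_oracle K').
Proof.
  intros H x Hx. unfold tree_oracle.
  assert (E : (exists s, strcode s = x /\ obeys K s) <-> (exists s, strcode s = x /\ obeys K' s)).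
  { split; intros (s & Hs & Ho); exists s; (split; [auto|]);
      intros t i b Ht Hi HK; apply (Ho t i b); auto;
      pose proof (length_le_strcode s); [rewrite H | rewrite <- H]; auto; lia. }
  destruct (excluded_middle_informative _), (excluded_middle_informative _); tauto.
Qed.

(** * Forcing with finite assignments and saturation *)

Definition pad (k : assignment) : nat -> nat * bool := fun t => nth t k (0, false).

(** With use bounded by [length k], the oracle bits read are fixed by the entries of [k], so the
    computation persists in every extension of [k]. *)
Definition force (e : code) (k : assignment) (X : nat -> bool) (i y : nat) : Prop :=
  graph e (length k) (Tjoin (tree_oracle (pad k)) X) i y.

Lemma graph_force K e s k X i y :
  s <= length k -> (forall t, t < s -> K t = pad k t) ->
  graph e s (Tjoin (tree_oracle K) X) i y -> force e k X i y.
Proof.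
  intros Hs HK. apply graph_mono; auto. apply agree_le with (2 * s); [lia|].
  apply agree_Tjoin; [|intros x Hx; auto]. now apply tree_oracle_agree.
Qed.

Lemma force_app e k h X i y : force e k X i y -> force e (k ++ h) X i y.
Proof.
  apply graph_force; [rewrite length_app; lia|].
  intros t Ht. unfold pad. now rewrite app_nth1.
Qed.

Lemma force_agree e k X Y i y : agree (length k) X Y -> force e k X i y -> force e k Y i y.
Proof.
  intros H. apply graph_mono; auto. apply agree_le with (2 * length k); [lia|].
  now apply agree_Tjoin_r.
Qed.

Lemma force_functional e k k' X i y y' : force e k X i y -> force e (k ++ k') X i y' -> y = y'.
Proof.
  intros H H'. apply force_app with (h := k') in H. exact (graph_functional _ _ _ _ _ _ _ H H').
Qed.

Definition pure (F : list nat) (k : assignment) : Prop :=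
  (forall i b b', In (i, b) k -> In (i, b') k -> b = b') /\
  (forall i b, In (i, b) k -> ~ In i F).

Definition growing (m : assignment -> R) : Prop :=
  forall k h, (0 <= m k <= 1)%R /\ (m k <= m (k ++ h))%R.

(** [k] is within [d] of the supremum of [m] over its extensions that leave [F] unset. *)
Definition saturated (F : list nat) (d : R) (k : assignment) (m : assignment -> R) : Prop :=
  forall h, pure F (k ++ h) -> (m (k ++ h) <= m k + d)%R.

(** Each failure of saturation provides an extension raising [m] by more than [d]; as [m] stays at
    most 1, this cannot be repeated forever. *)
Lemma saturate F d k m :
  (0 < d)%R -> growing m -> pure F k -> exists h, pure F (k ++ h) /\ saturated F d (k ++ h) m.
Proof.
  intros Hd Hm Hk. apply NNPP. intros Hno.
  assert (H : forall n, exists h, pure F (k ++ h) /\ (INR n * d <= m (k ++ h))%R).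
  { induction n as [|n (h & Hh & IH)].
    - exists []. rewrite app_nil_r. split; auto. cbn. destruct (Hm k []). lra.
    - assert (Hs : ~ saturated F d (k ++ h) m) by eauto.
      apply not_all_ex_not in Hs. destruct Hs as [h' Hs].
      apply imply_to_and in Hs. destruct Hs as [Hp Hs].
      exists (h ++ h'). rewrite app_assoc. split; auto.
      rewrite S_INR. apply Rnot_le_lt in Hs. lra. }
  destruct (INR_unbounded (/ d)) as [n Hn]. destruct (H n) as (h & _ & Hh).
  destruct (Hm (k ++ h) []) as [[_ H1] _].
  apply Rmult_lt_compat_r with (r := d) in Hn; auto. rewrite Rinv_l in Hn by lra. lra.
Qed.

Lemma saturated_app F d k h m :
  growing m -> saturated F d k m -> saturated F d (k ++ h) m.
Proof.
  intros Hm H h' Hp. rewrite <- app_assoc in *. destruct (Hm k h) as [_ H1].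
  specialize (H _ Hp). lra.
Qed.

Lemma saturate_all F d k (ms : list (assignment -> R)) :
  (0 < d)%R -> (forall m, In m ms -> growing m) -> pure F k ->
  exists h, pure F (k ++ h) /\ forall m, In m ms -> saturated F d (k ++ h) m.
Proof.
  intros Hd Hms Hk. induction ms as [|m ms IH].
  - exists []. rewrite app_nil_r. split; auto. intros m [].
  - destruct IH as (h & Hh & Hs); [intros; apply Hms; cbn; auto|].
    destruct (saturate F d (k ++ h) m) as (h' & Hh' & Hs'); auto; [apply Hms; cbn; auto|].
    exists (h ++ h'). rewrite app_assoc. split; auto.
    intros m' [<- | Hm']; auto. apply saturated_app; auto. apply Hms. cbn; auto.
Qed.

Definition converges (e : code) (m : nat) (k : assignment) : R :=
  pr (length k) (fun X => exists y, force e k X m y).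

Definition contradicts (e : code) (k : assignment) (X : nat -> bool) : Prop :=
  exists i b, force e k X i (Nat.b2n (negb b)) /\ In (i, b) k.

Definition excluded (e : code) (k : assignment) : R := pr (length k) (contradicts e k).

Lemma contradicts_app e k h X : contradicts e k X -> contradicts e (k ++ h) X.
Proof.
  intros (i & b & H1 & H2). exists i, b. split; [now apply force_app|].
  apply in_or_app. auto.
Qed.

Lemma contradicts_depends e k : depends (length k) (contradicts e k).
Proof.
  intros X Y HXY (i & b & H1 & H2). exists i, b. split; auto. now apply force_agree with X.
Qed.

Lemma growing_converges e m : growing (converges e m).
Proof.
  intros k h. split; [split; [apply pr_ge0 | apply pr_le1]|].
  apply pr_le_depends; [rewrite length_app; lia | |].
  - intros X Y HXY [y Hy]. exists y. now apply force_agree with X.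
  - intros X [y Hy]. exists y. now apply force_app.
Qed.

Lemma growing_excluded e : growing (excluded e).
Proof.
  intros k h. split; [split; [apply pr_ge0 | apply pr_le1]|].
  apply pr_le_depends; [rewrite length_app; lia | |].
  - apply contradicts_depends.
  - intros X. apply contradicts_app.
Qed.

(** The [X] on which [e] already converges under [k] yield boundedly many values, and these never
    change. A value above the bound comes from newly converging [X], whose measure saturation limits
    to [d]. *)
Lemma saturated_large_values F d k e m :
  saturated F d k (converges e m) -> exists b, forall h, pure F (k ++ h) ->
  (pr (length (k ++ h)) (fun X => exists y, (b < y)%nat /\ force e (k ++ h) X m y) <= d)%R.
Proof.
  intros Hs. destruct (depends_uniform (length k) (fun X y => force e k X m y)) as [b Hb].
  { intros y X Y HXY. now apply force_agree. }
  exists b. intros h Hh. specialize (Hs h Hh). unfold converges in Hs at 1.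
  assert (H := pr_disjoint (length (k ++ h)) (fun X => exists y, force e k X m y)
    (fun X => exists y, (b < y)%nat /\ force e (k ++ h) X m y)
    (fun X => exists y, force e (k ++ h) X m y)).
  assert (H' : (converges e m k <=
      pr (length (k ++ h)) (fun X => exists y, force e k X m y))%R).
  { apply pr_le_depends; [rewrite length_app; lia | | auto].
    intros X Y HXY [y Hy]. exists y. now apply force_agree with X. }
  enough (pr (length (k ++ h)) (fun X => exists y, force e k X m y) +
    pr (length (k ++ h)) (fun X => exists y, (b < y)%nat /\ force e (k ++ h) X m y) <=
    pr (length (k ++ h)) (fun X => exists y, force e (k ++ h) X m y))%R by lra.
  apply H.
  - intros X HX (y & Hy & Hy'). apply Hb in HX. destruct HX as (y' & Hle & Hf).
    assert (y' = y) by (eapply force_functional; eauto). lia.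
  - intros X [[y Hy] | (y & _ & Hy)]; exists y; auto. now apply force_app.
Qed.

Definition compatible_up_to (l : nat) (e : code) (k : assignment) (X : nat -> bool) : Prop :=
  forall i, i <= l -> exists b, force e k X i (Nat.b2n b) /\ forall b', In (i, b') k -> b' = b.

(* Setting the free position [l] to one of its two values excludes the functionals that predict the other value there. *)
Lemma saturated_split F d k e l :
  saturated F d k (excluded e) -> ~ In l F -> (forall i b, In (i, b) k -> i < l) ->
  forall h, pure (l :: F) (k ++ h) ->
  (pr (length (k ++ h)) (compatible_up_to l e (k ++ h)) <= 2 * d)%R.
Proof.
  intros Hs HlF Hl h Hh.
  set (k' := k ++ h) in *.
  (* Deciding [l] as [negb c] puts all of [G c] among the contradicting sets. These are new: all
     positions of [k] lie below [l], where [G c] is compatible. *)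
  pose (G := fun c X => compatible_up_to l e k' X /\ force e k' X l (Nat.b2n c)).
  assert (HG : forall c, (pr (length k') (G c) <= d)%R).
  { intros c. pose (k'' := k' ++ [(l, negb c)]).
    assert (Hk'' : k'' = k ++ (h ++ [(l, negb c)])) by (symmetry; apply app_assoc).
    (* The comparison condition may set [l], because saturation holds relative to [F], before [l] is
       reserved. *)
    assert (Hp : pure F k'').
    { destruct Hh as [Hc HF].
      assert (Hnl : forall b, ~ In (l, b) k').
      { intros b Hb. apply (HF l b Hb). cbn; auto. }
      split.
      - intros i b b' H1 H2. apply in_app_or in H1, H2.
        destruct H1 as [H1 | [H1 | []]], H2 as [H2 | [H2 | []]]; eauto; try congruence;
          [inversion H2 | inversion H1]; subst; exfalso; eapply Hnl; eauto.
      - intros i b H1 H2. apply in_app_or in H1. destruct H1 as [H1 | [H1 | []]].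
        + apply (HF i b H1). cbn; auto.
        + congruence. }
    assert (Hx : (excluded e k'' <= excluded e k + d)%R).
    { rewrite Hk''. apply Hs. now rewrite <- Hk''. }
    enough (pr (length k'') (G c) + pr (length k'') (contradicts e k) <= excluded e k'')%R.
    { assert (pr (length k') (G c) <= pr (length k'') (G c))%R.
      { apply pr_le_depends; auto.
        - unfold k''. rewrite length_app. lia.
        - intros X Y HXY [H1 H2]. split; [|now apply force_agree with X].
          intros i Hi. destruct (H1 i Hi) as (b & H3 & H4). exists b. split; auto.
          now apply force_agree with X. }
      assert (excluded e k <= pr (length k'') (contradicts e k))%R.
      { apply pr_le_depends; auto using contradicts_depends.
        rewrite Hk'', length_app. lia. }
      lra. }
    apply pr_disjoint.
    - intros X [HX _] (i & b & H1 & H2).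
      assert (Hi := Hl i b H2). destruct (HX i) as (b' & H3 & H4); [lia|].
      assert (b = b') by (apply H4; apply in_or_app; auto). subst b'.
      assert (Nat.b2n (negb b) = Nat.b2n b) by (eapply force_functional; eauto).
      destruct b; discriminate.
    - intros X [[_ HX] | HX].
      + exists l, (negb c). rewrite Bool.negb_involutive. split; [now apply force_app|].
        apply in_or_app. cbn; auto.
      + rewrite Hk''. now apply contradicts_app. }
  apply Rle_trans with (pr (length k') (G true) + pr (length k') (G false))%R.
  - apply pr_or. intros X HX. destruct (HX l (le_n l)) as ([|] & Hb & _);
      [left | right]; (split; auto).
  - assert (H1 := HG true). assert (H2 := HG false). lra.
Qed.

(** Undecided positions below [n] outside [F] receive [false], which leaves only reserved positions
    free there. *)
Lemma fill F k n :
  pure F k -> exists h, pure F (k ++ h) /\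
    (forall i, i < n -> In i F \/ exists b, In (i, b) (k ++ h)) /\
    (forall i b, In (i, b) h -> i < n).
Proof.
  intros Hk. induction n as [|n (h & Hh & H1 & H2)].
  - exists []. rewrite app_nil_r. repeat split; try apply Hk; [lia|]. intros i b [].
  - destruct (classic (In n F \/ exists b, In (n, b) (k ++ h))) as [Hn | Hn].
    + exists h. split; [auto|]. split.
      * intros i Hi. destruct (Nat.eq_dec i n) as [->|]; auto. apply H1. lia.
      * intros i b Hi. specialize (H2 i b Hi). lia.
    + exists (h ++ [(n, false)]). rewrite app_assoc. split; [|split].
      * destruct Hh as [Hc HF]. split.
        -- intros i b b' H3 H4. apply in_app_or in H3, H4.
           destruct H3 as [H3 | [H3 | []]], H4 as [H4 | [H4 | []]]; eauto; try congruence;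
             [inversion H4 | inversion H3]; subst; exfalso; eauto.
        -- intros i b H3 H4. apply in_app_or in H3. destruct H3 as [H3 | [H3 | []]].
           ++ now apply (HF i b).
           ++ inversion H3; subst; auto.
      * intros i Hi. destruct (Nat.eq_dec i n) as [->|].
        -- right. exists false. apply in_or_app. cbn; auto.
        -- destruct (H1 i) as [H | [b H]]; [lia | auto|].
           right. exists b. apply in_or_app. auto.
      * intros i b H. apply in_app_or in H. destruct H as [H | [H | []]].
        -- specialize (H2 i b H). lia.
        -- inversion H; lia.
Qed.

Lemma list_strict_bound (k : list nat) : exists n, forall i, In i k -> i < n.
Proof.
  exists (S (list_max k)). intros i Hi.
  assert (H := proj1 (list_max_le k (list_max k)) (le_n _)).
  rewrite Forall_forall in H. specialize (H i Hi). lia.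
Qed.

(* A state is a pair of an assignment and the list, newest first, of positions that are never to be set. *)
Definition stage (n : nat) (st st' : assignment * list nat) : Prop :=
  exists l h, st' = (fst st ++ h, l :: snd st) /\ h <> [] /\
    (forall i, i < l -> In i (snd st) \/ exists b, In (i, b) (fst st')) /\
    (forall e, encode e <= n -> forall h', pure (snd st') (fst st' ++ h') ->
      (pr (length (fst st' ++ h'))
        (fun X => exists y, (l < y)%nat /\ force e (fst st' ++ h') X (Datatypes.S n) y)
        <= (1 / 2) ^ n)%R /\
      (pr (length (fst st' ++ h')) (compatible_up_to l e (fst st' ++ h'))
        <= 2 * (1 / 2) ^ n)%R).

(** The order matters: saturate over [F], read off the value bound [b], choose [l] beyond it, fill
    below [l], and only then reserve [l]. *)
Lemma stage_exists n st :
  pure (snd st) (fst st) -> exists st', pure (snd st') (fst st') /\ stage n st st'.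
Proof.
  destruct st as [k F]. cbn [fst snd]. intros Hk.
  pose (es := map decode (seq 0 (S n))).
  assert (Hes : forall e, encode e <= n -> In e es).
  { intros e He. rewrite <- (decode_encode e). apply in_map, in_seq. lia. }
  destruct (saturate_all F ((1 / 2) ^ n) k
    (map (fun e => converges e (S n)) es ++ map excluded es)) as (h1 & Hp1 & Hs).
  { apply half_pow_pos. }
  { intros m Hm. apply in_app_or in Hm.
    destruct Hm as [Hm | Hm]; apply in_map_iff in Hm; destruct Hm as (e & <- & _).
    - apply growing_converges.
    - apply growing_excluded. }
  { exact Hk. }
  set (k1 := k ++ h1) in *.
  destruct (bounded_uniform (fun c b => forall h, pure F (k1 ++ h) ->
    (pr (length (k1 ++ h))
      (fun X => exists y, (b < y)%nat /\ force (decode c) (k1 ++ h) X (S n) y)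
      <= (1 / 2) ^ n)%R) (S n)) as [b Hb].
  { intros c b b' Hle H h Hh. apply Rle_trans with (2 := H h Hh). apply pr_le.
    intros X (y & Hy & Hf). exists y. split; auto. lia. }
  { intros c Hc. apply saturated_large_values. apply Hs, in_or_app. left.
    apply (in_map (fun e => converges e (S n))). apply in_map, in_seq. lia. }
  destruct (list_strict_bound (map fst k1)) as [N1 HN1].
  destruct (list_strict_bound F) as [N2 HN2].
  (* Both numbers lie beyond all positions in [k1] and [F]. The extra position [l0] below [l] is
     still undecided, so filling appends at least one entry and the stage is nontrivial. *)
  set (l0 := b + N1 + N2). set (l := S l0).
  destruct (fill F k1 l Hp1) as (h2 & Hp2 & Hfill & Hdom).
  assert (Hk1 : forall i c, In (i, c) k1 -> i < l0).
  { intros i c Hi. apply (in_map fst), HN1 in Hi. cbn in Hi. lia. }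
  assert (HlF : ~ In l F) by (intros Hl; apply HN2 in Hl; lia).
  exists (k1 ++ h2, l :: F). cbn [fst snd].
  assert (Hpl : pure (l :: F) (k1 ++ h2)).
  { destruct Hp2 as [Hc HF]. split; auto. intros i c Hi [<- | Hi'].
    - apply in_app_or in Hi. destruct Hi as [Hi | Hi]; [apply Hk1 in Hi | apply Hdom in Hi]; lia.
    - now apply (HF i c). }
  split; [exact Hpl|].
  exists l, (h1 ++ h2). cbn [fst snd]. split; [unfold k1; now rewrite app_assoc|].
  split; [|split; [exact Hfill|]].
  - intros Hnil. apply app_eq_nil in Hnil. destruct Hnil as [_ ->].
    rewrite app_nil_r in Hfill. destruct (Hfill l0) as [H | [c H]]; [lia | |].
    + apply HN2 in H. lia.
    + apply Hk1 in H. lia.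
  - intros e He h' Hp. rewrite <- app_assoc in *.
    assert (HpF : pure F (k1 ++ h2 ++ h')).
    { destruct Hp as [Hc HF]. split; auto. intros i c Hi Hi'. apply (HF i c Hi). cbn; auto. }
    split.
    + apply Rle_trans with (pr (length (k1 ++ h2 ++ h'))
        (fun X => exists y, (b < y)%nat /\ force e (k1 ++ h2 ++ h') X (S n) y)).
      * apply pr_le. intros X (y & Hy & Hf). exists y. split; auto. lia.
      * rewrite <- (decode_encode e). apply Hb; auto. lia.
    + apply saturated_split with F; auto.
      * apply Hs, in_or_app. right. apply in_map. auto.
      * intros i c Hi. apply Hk1 in Hi. lia.
Qed.

(* A functional computing a path of the tree satisfies the first clause at every [j], one computing a function not eventually bounded by [p] satisfies the second. *)
Definition narrow_test (K : nat -> nat * bool) (p : nat -> nat)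
  (j : nat) (g : nat -> nat -> Prop) : Prop :=
  (forall i, i < j -> exists b, g i (Nat.b2n b) /\ forall t b', K t = (i, b') -> b' = b) \/
  (exists m y, j <= m /\ p m < y /\ g (S m) y).

Lemma narrow_test_monotone K p : monotone_test (narrow_test K p).
Proof.
  intros j g g' H [H1 | (m & y & H1 & H2 & H3)].
  - left. intros i Hi. destruct (H1 i Hi) as (b & Hb & Hb'). exists b. auto.
  - right. exists m, y. auto.
Qed.

(** [K] is the limit of the assignments of an infinite run of [stage], and [p n] is the position
    reserved at stage [n]. *)
Lemma generic_tree : exists (K : nat -> nat * bool) (p : nat -> nat),
  (forall t t' i b b', K t = (i, b) -> K t' = (i, b') -> b = b') /\
  (forall n i, i < p n -> (forall t b, K t <> (i, b)) -> In i (map p (seq 0 n))) /\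
  good (narrow_test K p) (tree_oracle K).
Proof.
  destruct (dependent_sequence (assignment * list nat)
    (fun _ st => pure (snd st) (fst st)) stage ([], [])) as (st & Hst0 & Hst).
  { split; intros i b; [intros ? [] | intros []]. }
  { intros n st Hst. now apply stage_exists. }
  pose (ka := fun n => fst (st n)).
  pose (p := fun n => hd 0 (snd (st (S n)))).
  (* Every stage lengthens the assignment, so [ka (S t)] has an entry at index [t]. *)
  pose (K := fun t => pad (ka (S t)) t).
  assert (Hstep : forall n, exists h, ka (S n) = ka n ++ h /\ h <> []).
  { intros n. destruct (Hst n) as [_ (l & h & E & Hh & _)]. exists h. split; auto.
    unfold ka. now rewrite E. }
  assert (Hext : forall m n, m <= n -> exists h, ka n = ka m ++ h).
  { intros m n Hmn. induction Hmn as [|n Hmn [h IH]].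
    - exists []. now rewrite app_nil_r.
    - destruct (Hstep n) as (h' & E & _). exists (h ++ h'). rewrite E, IH.
      now rewrite app_assoc. }
  assert (Hlen : forall n, n <= length (ka n)).
  { induction n as [|n IH]; [lia|]. destruct (Hstep n) as (h & -> & Hh).
    rewrite length_app. destruct h; [easy | cbn; lia]. }
  assert (HK : forall n t, t < length (ka n) -> K t = pad (ka n) t).
  { intros n t Ht. unfold K, pad.
    destruct (Nat.le_ge_cases (S t) n) as [H | H]; destruct (Hext _ _ H) as [h E]; rewrite E.
    - symmetry. apply app_nth1. apply (Hlen (S t)).
    - now apply app_nth1. }
  assert (HKin : forall n x, In x (ka n) -> exists t, K t = x).
  { intros n x Hx. destruct (In_nth _ _ (0, false) Hx) as (t & Ht & E).
    exists t. rewrite (HK n); auto. }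
  assert (HinK : forall n t, t < length (ka n) -> In (K t) (ka n)).
  { intros n t Ht. rewrite (HK n) by auto. now apply nth_In. }
  assert (HF : forall n, snd (st (S n)) = p n :: snd (st n)).
  { intros n. unfold p. destruct (Hst n) as [_ (l & h & E & _)]. now rewrite E. }
  assert (HFin : forall n i, In i (snd (st n)) -> In i (map p (seq 0 n))).
  { induction n as [|n IH]; intros i Hi.
    - now rewrite Hst0 in Hi.
    - rewrite HF in Hi. rewrite seq_S, map_app. apply in_or_app.
      destruct Hi as [<- | Hi]; [right; cbn; auto | left; auto]. }
  (* The bounds of stage [n] concern all extensions respecting the reserved positions, hence all
     later stages. *)
  assert (Hbounds : forall n e N, encode e <= n -> n < N ->
     (pr (length (ka N)) (fun X => exists y, (p n < y)%nat /\ force e (ka N) X (S n) y)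
        <= (1 / 2) ^ n)%R /\
     (pr (length (ka N)) (compatible_up_to (p n) e (ka N)) <= 2 * (1 / 2) ^ n)%R).
  { intros n e N He HN. destruct (Hext (S n) N HN) as [h E].
    assert (HFmono : forall i, In i (snd (st (S n))) -> In i (snd (st N))).
    { clear - HF HN. induction HN as [|N HN IH]; auto.
      intros i Hi. rewrite HF. right. auto. }
    destruct (Hst n) as [_ (l & h0 & E0 & _ & _ & H)].
    assert (l = p n) by (unfold p; now rewrite E0). subst l.
    specialize (H e He h). fold (ka (S n)) in H. rewrite <- E in H.
    apply H. destruct (Hst N) as [[Hc HpF] _]. split; [exact Hc|].
    intros i b Hi Hi'. apply (HpF i b Hi). auto. }
  exists K, p. split; [|split].
  - intros t t' i b b' H1 H2. destruct (Hst (S t + S t')) as [[Hc _] _].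
    apply (Hc i).
    + fold (ka (S t + S t')). rewrite <- H1. apply HinK.
      pose proof (Hlen (S t + S t')). lia.
    + fold (ka (S t + S t')). rewrite <- H2. apply HinK.
      pose proof (Hlen (S t + S t')). lia.
  - intros n i Hi Hno. destruct (Hst n) as [_ (l & h & E & _ & Hfill & _)].
    assert (l = p n) by (unfold p; now rewrite E). subst l.
    destruct (Hfill i Hi) as [H | [b H]]; [auto|].
    exfalso. apply HKin in H. destruct H as [t Ht]. exact (Hno t b Ht).
  - intros e eps Heps. destruct (half_pow_small (eps / 4)) as [k0 Hk0]; [lra|].
    set (k := k0 + encode e).
    assert (Hk : ((1 / 2) ^ k < eps / 4)%R).
    { apply Rle_lt_trans with (2 := Hk0). apply half_pow_le. lia. }
    (* This index exceeds [p k], so the first clause of the test implies compatibility up to [p k];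
       it is at least [k], so the second clause only involves stages that handle [e]. *)
    exists (S (p k) + k). intros s.
    assert (Hgf : forall N X i y, s <= N ->
      graph e s (Tjoin (tree_oracle K) X) i y -> force e (ka N) X i y).
    { intros N X i y HsN. pose proof (Hlen N). apply graph_force; [lia|].
      intros t Ht. apply HK. lia. }
    pose (V := fun i X => exists y, p (k + i) < y /\
      graph e s (Tjoin (tree_oracle K) X) (S (k + i)) y).
    assert (HVd : forall i, depends s (V i)).
    { intros i X Y HXY (y & Hy & H). exists y. split; auto. revert H.
      apply graph_mono; auto. apply agree_le with (2 * s); [lia|]. now apply agree_Tjoin_r. }
    (* At fixed use [s], finitely many [i] account for the whole second clause, which makes a finite
       union bound applicable. *)
    destruct (depends_uniform s (fun X i => V i X) HVd) as [M HM].
    apply Rle_trans with (2 * (1 / 2) ^ k + 2 * (1 / 2) ^ k)%R; [|lra].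
    apply Rle_trans with
      (pr s (fun X => forall i : nat, (i < S (p k) + k)%nat -> exists b,
         graph e s (Tjoin (tree_oracle K) X) i (Nat.b2n b) /\
         forall t b', K t = (i, b') -> b' = b) +
       pr s (fun X => exists i : nat, (i < S M)%nat /\ V i X))%R.
    { apply pr_or. intros X [HX | (m & y & Hm & Hy & HX)]; [left; exact HX|].
      right. destruct (HM X) as (i & Hi & HVi).
      - exists (m - k). exists y. replace (k + (m - k)) with m by lia. auto.
      - exists i. split; auto. lia. }
    apply Rplus_le_compat.
    + set (N := S k + s). apply Rle_trans with (pr (length (ka N)) (compatible_up_to (p k) e (ka N))).
      * apply pr_le_depends; [pose proof (Hlen N); lia | |].
        -- intros X Y HXY H i Hi. destruct (H i Hi) as (b & Hb & Hb'). exists b. split; auto.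
           revert Hb. apply graph_mono; auto. apply agree_le with (2 * s); [lia|].
           now apply agree_Tjoin_r.
        -- intros X H i Hi. destruct (H i) as (b & Hb & Hb'); [lia|]. exists b. split.
           ++ apply Hgf; auto. lia.
           ++ intros b' Hin. apply HKin in Hin. destruct Hin as [t Ht]. eauto.
      * apply Hbounds; lia.
    (* The factor 2 turns the stage bounds [(1 / 2) ^ (k + i)] into the weights [(1 / 2) ^ S i] of
       the union bound. *)
    + apply Rle_trans with (2 * (1 / 2) ^ k * (1 - (1 / 2) ^ S M))%R.
      * apply pr_union_bound. intros i. set (N := S (k + i) + s).
        apply Rle_trans with (pr (length (ka N))
          (fun X => exists y, (p (k + i) < y)%nat /\ force e (ka N) X (S (k + i)) y)).
        -- apply pr_le_depends; auto; [pose proof (Hlen N); lia|].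
           intros X (y & Hy & H). exists y. split; auto. apply Hgf; auto. lia.
        -- destruct (Hbounds (k + i) e N) as [H _]; [lia | lia |].
           apply Rle_trans with (1 := H). rewrite pow_add. cbn. lra.
      * pose proof (half_pow_pos (S M)). pose proof (half_pow_pos k).
        apply Rle_trans with (2 * (1 / 2) ^ k * 1)%R; [|lra].
        apply Rmult_le_compat_l; lra.
Qed.
(** * The model *)

(** Running the code of [f] on the left half of [Z + X] gives the same values for every [X], so a
    passed test would have measure 1. Restricting to arguments below [L] gives all these
    computations a common use. *)
Lemma good_not_computed D Z f :
  monotone_test D -> good D Z -> computable_in Z f ->
  exists j, forall L, ~ D j (fun i y => i < L /\ y = f i).
Proof.
  intros HD HZ [d Hd]. destruct (HZ (plug cevens d) (1 / 2)%R) as [j Hj]; [lra|].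
  exists j. intros L HL.
  destruct (bounded_uniform (fun i s => forall B, agree s Z B -> eval B d [i] (f i)) L)
    as [s Hs].
  { intros i s t Hst H B HB. apply H. now apply agree_le with t. }
  { intros i _. now apply eval_use. }
  specialize (Hj (2 * s)). rewrite pr_true in Hj; [lra|].
  intros X. revert HL. apply HD. intros i y [Hi ->] Y HY.
  apply eval_plug with (evens Y); [apply computes_cevens|].
  apply Hs; auto. rewrite <- (evens_Tjoin Z X). now apply agree_evens.
Qed.

Lemma length_prefix X n : length (prefix X n) = n.
Proof. induction n as [|n IH]; cbn; auto. rewrite length_app, IH. cbn. lia. Qed.

Lemma nth_prefix X n i : i < n -> nth i (prefix X n) false = X i.
Proof.
  induction n as [|n IH]; intros Hi; [lia|]. cbn.
  destruct (Nat.eq_dec i n) as [->|].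
  - rewrite app_nth2, length_prefix, Nat.sub_diag; [reflexivity|]. rewrite length_prefix. lia.
  - rewrite app_nth1; [apply IH; lia|]. rewrite length_prefix. lia.
Qed.

Lemma in_all_strings s : In s (all_strings (length s)).
Proof.
  induction s as [|b s IH]; cbn; auto. apply in_or_app.
  destruct b; [right | left]; now apply in_map.
Qed.

Lemma infinite_strs_long P n : infinite_strs P -> exists x, P x /\ n < length x.
Proof.
  intros H. destruct (H (flat_map all_strings (seq 0 (S n)))) as (x & Hx & Hn).
  exists x. split; auto. apply Nat.nle_gt. intros Hle. apply Hn.
  apply in_flat_map. exists (length x). split; [apply in_seq; lia | apply in_all_strings].
Qed.

Lemma revealed_tree_is_tree K : is_tree (revealed_tree K).
Proof.
  intros s u H. apply revealed_tree_true in H. apply revealed_tree_true.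
  intros t i b Ht Hi HK. rewrite <- (app_nth1 s u) by auto.
  apply (H t); auto; rewrite length_app; lia.
Qed.

(** The positions revealed as [true] form a path, by consistency of [K]. *)
Lemma revealed_tree_infinite K :
  (forall t t' i b b', K t = (i, b) -> K t' = (i, b') -> b = b') ->
  infinite_strs (fun s => revealed_tree K s = true).
Proof.
  intros HK l. destruct (list_strict_bound (map (@length bool) l)) as [N HN].
  pose (A := fun i => if excluded_middle_informative (exists t, K t = (i, true))
    then true else false).
  exists (prefix A N). split.
  - apply revealed_tree_true. intros t i b Ht Hi HKt. rewrite length_prefix in *.
    rewrite nth_prefix by auto. unfold A.
    destruct (excluded_middle_informative _) as [[t' Ht'] | Hno]; [eauto|].
    destruct b; auto. exfalso. eauto.
  - intros Hin. apply (in_map (@length bool)), HN in Hin. rewrite length_prefix in Hin. lia.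
Qed.

(** If stage [t] reveals bit [b] at level [length s], the child of [s] with the other bit has no
    extension longer than [t] in the tree. *)
Lemma branching_not_revealed K s t b :
  branching (revealed_tree K) s -> K t <> (length s, b).
Proof.
  intros (_ & H0 & H1) HK.
  assert (H : extendible (revealed_tree K) (s ++ [negb b])) by (destruct b; auto).
  destruct (infinite_strs_long _ t H) as (x & [Hx [u ->]] & Ht).
  apply revealed_tree_true in Hx. specialize (Hx t (length s) b Ht).
  rewrite <- app_assoc, !length_app, app_nth2, Nat.sub_diag in Hx by lia. cbn in Hx.
  assert (negb b = b) by (apply Hx; auto; lia). now destruct b.
Qed.

Lemma path_not_computed K p Z P :
  good (narrow_test K p) Z -> Treducible P Z -> ~ is_path (revealed_tree K) P.
Proof.
  intros HZ HP Hpath.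
  destruct (good_not_computed _ _ _ (narrow_test_monotone K p) HZ HP) as [j Hj].
  apply (Hj j). left. intros i Hi. exists (P i). split; [split; auto|].
  (* This prefix is long enough both to contain position [i] and to be bound by stage [t]. *)
  intros t b HK. specialize (Hpath (S (t + i))). apply revealed_tree_true in Hpath.
  rewrite <- (nth_prefix P (S (t + i)) i) by lia. symmetry.
  apply (Hpath t i b); auto; rewrite length_prefix; lia.
Qed.

Lemma computable_dominated K p Z f :
  good (narrow_test K p) Z -> computable_in Z f ->
  exists N, forall m, N <= m -> f (S m) <= p m.
Proof.
  intros HZ Hf.
  destruct (good_not_computed _ _ _ (narrow_test_monotone K p) HZ Hf) as [j Hj].
  exists j. intros m Hm. apply Nat.nlt_ge. intros Hlt. apply (Hj (S (S m))).
  right. exists m, (f (S m)). auto.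
Qed.

Lemma level_count_full n : level_count (fun _ => true) n = 2 ^ n.
Proof.
  induction n as [|n IH]; [reflexivity|]. rewrite level_count_succ, IH. cbn. lia.
Qed.

(* Stage [n], the pair of [c] and [a], adds a path of the tree computed by code [c] from the oracle of stage [a]; this oracle is recovered from [Z] by [n - a] left projections. *)
Definition adds_path (n : nat) (Z Z' : nat -> bool) : Prop :=
  exists X, Z' = Tjoin Z X /\
    forall c a S u v, n = Cantor.to_nat (c, a) -> is_tree S -> 0 < u -> 0 < v ->
      (forall l, u * 2 ^ l <= level_count S l * v) ->
      (forall s, eval (Nat.iter (n - a) evens Z) (decode c) [strcode s] (Nat.b2n (S s))) ->
      is_path S X.

Lemma adds_path_exists D n Z :
  monotone_test D -> good D Z -> exists Z', good D Z' /\ adds_path n Z Z'.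
Proof.
  intros HD HZ.
  destruct (classic (exists c a S u v, n = Cantor.to_nat (c, a) /\ is_tree S /\ 0 < u /\ 0 < v /\
      (forall l, u * 2 ^ l <= level_count S l * v) /\
      (forall s, eval (Nat.iter (n - a) evens Z) (decode c) [strcode s] (Nat.b2n (S s)))))
    as [(c & a & S & u & v & En & HS & Hu & Hv & Hw & He) | Hno].
  - destruct (good_extend D Z S u v) as (X & HX & HG); auto.
    exists (Tjoin Z X). split; auto. exists X. split; auto.
    intros c' a' S' u' v' En' _ _ _ _ He'.
    rewrite En in En'. apply Cantor.to_nat_inj, pair_equal_spec in En'.
    destruct En' as [<- <-].
    replace S' with S; auto. apply functional_extensionality. intros s.
    assert (E := eval_functional _ _ _ _ _ (He s) (He' s)).
    destruct (S s), (S' s); auto; discriminate.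
  (* If stage [n] codes no suitable tree, a path of the full tree is joined, so that every stage
     adds exactly one component. *)
  - destruct (good_extend D Z (fun _ => true) 1 1) as (X & _ & HG); auto.
    { intros s t _. reflexivity. }
    { intros l. rewrite level_count_full. lia. }
    exists (Tjoin Z X). split; auto. exists X. split; auto.
    intros c a S u v En HS Hu Hv Hw He. exfalso. apply Hno.
    exists c, a, S, u, v. auto 10.
Qed.

Definition below_some (Z : nat -> nat -> bool) (B : nat -> bool) : Prop :=
  exists n, Treducible B (Z n).

Lemma chain_Treducible (Z : nat -> nat -> bool) m n :
  (forall n, adds_path n (Z n) (Z (S n))) -> m <= n -> Treducible (Z m) (Z n).
Proof.
  intros HZ Hmn. induction Hmn as [|n Hmn IH]; [apply Treducible_refl|].
  apply Treducible_trans with (Z n); auto.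
  destruct (HZ n) as (X & -> & _). apply Treducible_Tjoin_l.
Qed.

Lemma below_some_ideal Z :
  (forall n, adds_path n (Z n) (Z (S n))) -> Turing_ideal (below_some Z).
Proof.
  intros HZ. split; [|split].
  - exists (Z 0), 0. apply Treducible_refl.
  - intros A B [m HA] [n HB]. exists (m + n). apply Treducible_Tjoin.
    + apply Treducible_trans with (Z m); auto. apply chain_Treducible; auto. lia.
    + apply Treducible_trans with (Z n); auto. apply chain_Treducible; auto. lia.
  - intros A B [n HA] HB. exists n. now apply Treducible_trans with A.
Qed.

Lemma below_some_WWKL Z :
  (forall n, adds_path n (Z n) (Z (S n))) -> WWKL_in (below_some Z).
Proof.
  intros HZ T (X & [a [c Hc]] & HX) HT (u & v & Hu & Hv & Hw).
  set (n := Cantor.to_nat (encode c, a)).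
  (* The pairing dominates its components, so the oracle [Z a] is already available when its request
     is served. *)
  assert (Han : a <= n).
  { pose proof (Cantor.to_nat_non_decreasing (encode c) a). unfold n. lia. }
  assert (Hiter : forall k, Nat.iter k evens (Z (k + a)) = Z a).
  { induction k as [|k IH]; [reflexivity|]. rewrite Nat.iter_succ_r.
    cbn [Nat.add]. destruct (HZ (k + a)) as (R' & -> & _). now rewrite evens_Tjoin. }
  destruct (HZ n) as (P & HP & Hpath). exists P. split.
  - exists (S n). rewrite HP. apply Treducible_Tjoin_r.
  - apply Hpath with (encode c) a u v; auto.
    intros s. replace (Z n) with (Z (n - a + a)) by (f_equal; lia).
    rewrite Hiter, decode_encode, <- HX. apply Hc.
Qed.

Theorem mainTheorem1 :
  exists M : (nat -> bool) -> Prop,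
    Turing_ideal M /\ WWKL_in M /\ ~ VSMALL_in M.
Proof.
  destruct generic_tree as (K & p & HK & Hfree & Hgood).
  destruct (dependent_sequence (nat -> bool) (fun _ Z => good (narrow_test K p) Z) adds_path
    (tree_oracle K)) as (Z & HZ0 & HZ); auto.
  { intros n Z HZ. apply adds_path_exists; auto using narrow_test_monotone. }
  assert (Hadd : forall n, adds_path n (Z n) (Z (S n))) by (intros n; apply HZ).
  exists (below_some Z).
  split; [now apply below_some_ideal|]. split; [now apply below_some_WWKL|].
  intros Hsmall. destruct (Hsmall (revealed_tree K)) as (P & [n HP] & Hpath).
  - exists (tree_oracle K). split; [|apply tree_oracle_strcode].
    exists 0. rewrite HZ0. apply Treducible_refl.
  - apply revealed_tree_is_tree.
  - now apply revealed_tree_infinite.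
  - intros (f & (X & [n HX] & Hf) & Hmany).
    destruct (computable_dominated K p (Z n) f) as [N HN]; [apply HZ | |].
    { now apply computable_in_trans with X. }
    destruct (Hmany (S N)) as (m & Hm & l & Hnd & Hlen & Hl).
    destruct m as [|m]; [lia|].
    (* The list [l] has [S m] distinct branching levels below [f (S m)], hence below [p m]; but only
       the [m] values [p 0] to [p (m - 1)] can be free there. *)
    assert (Hincl : incl l (map p (seq 0 m))).
    { intros k Hk. destruct (Hl k Hk) as [Hkf (s & <- & Hs)]. apply Hfree.
      - specialize (HN m). lia.
      - intros t b. now apply branching_not_revealed. }
    apply NoDup_incl_length in Hincl; auto. rewrite length_map, length_seq in Hincl. lia.
  - apply (path_not_computed K p (Z n) P); auto. apply HZ.
Qed.
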